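(* Let $U_{r,n}$ be the full simplicial complex of dimension $r$ on a set $X=\{f_1,\dots,f_n\}$ of size $n$, i.e. the family of all subsets of $X$ of size at most $r$. Then $\dim_{\mathbb{E}}(U_{r,n})\geq\min(2r,n-1)$.
   Context: A realization of a family $\mathcal{S}\subseteq 2^U$ ($U$ finite) in $\mathbb{R}^m$ consists of oriented affine hyperplanes $(H_e)_{e\in U}$ of $\mathbb{R}^m$, where $H_e=\{x:a_e\cdot x=b_e\}$ with $a_e\neq 0$, $H_e^+=\{x:a_e\cdot x>b_e\}$, $H_e^-=\{x:a_e\cdot x<b_e\}$, and a relatively open convex set $K\subseteq\mathbb{R}^m$ such that $Y\subseteq U$ belongs to $\mathcal{S}$ if and only if there is $x\in K$ with $x\in H_e^+$ for all $e\in Y$ and $x\in H_e^-$ for all $e\in U\setminus Y$. The Euclidean dimension $\dim_{\mathbb{E}}(\mathcal{S})$ is the smallest $m$ such that $\mathcal{S}$ has a realization in $\mathbb{R}^m$. Here the universe is $U=X$. *)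

(* Defs.v *)
From mathcomp Require Import all_boot all_order all_algebra.
From mathcomp Require Import all_classical all_reals all_analysis.

Set Implicit Arguments.
Unset Strict Implicit.
Unset Printing Implicit Defensive.

Import Order.TTheory GRing.Theory Num.Theory.
Import numFieldNormedType.Exports.

Local Open Scope classical_set_scope.
Local Open Scope ring_scope.

Definition dotmx (R : realType) (m : nat) (u v : 'rV[R]_m) : R :=
  \sum_(i < m) u ord0 i * v ord0 i.

Definition affine_hull (R : realType) (m : nat) (A : set 'rV[R]_m) :
    set 'rV[R]_m :=
  [set x | exists (k : nat) (t : 'I_k -> R) (p : 'I_k -> 'rV[R]_m),
    [/\ forall i, A (p i), \sum_i t i = 1 & x = \sum_i t i *: p i]].

Definition relatively_open (R : realType) (m : nat) (A : set 'rV[R]_m) : Prop :=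
  exists2 O : set 'rV[R]_m, open O & A = O `&` affine_hull A.

Definition pos_side (R : realType) (m : nat) (a : 'rV[R]_m) (b : R) :
    set 'rV[R]_m := [set x | b < dotmx a x].

Definition neg_side (R : realType) (m : nat) (a : 'rV[R]_m) (b : R) :
    set 'rV[R]_m := [set x | dotmx a x < b].

Definition is_realization (R : realType) (U : finType) (S : {set {set U}})
    (m : nat) (a : U -> 'rV[R]_m) (b : U -> R) (K : set 'rV[R]_m) : Prop :=
  [/\ forall e, a e != 0,
      relatively_open K,
      convex_set K &
      forall Y : {set U}, Y \in S <->
        exists x, [/\ K x,
          forall e, e \in Y -> pos_side (a e) (b e) x &
          forall e, e \notin Y -> neg_side (a e) (b e) x]].

Definition has_realization (R : realType) (U : finType) (S : {set {set U}})
    (m : nat) : Prop :=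
  exists (a : U -> 'rV[R]_m) (b : U -> R) (K : set 'rV[R]_m),
    is_realization S a b K.

(* The default value 0 is taken only by families without any realization, so a
   positive lower bound on the dimension entails that a realization exists. *)
Definition euclidean_dim (R : realType) (U : finType) (S : {set {set U}}) :
    nat :=
  xget 0%N [set m | has_realization R S m /\
                    forall k, has_realization R S k -> (m <= k)%N].

(* The dimension r is the maximal size of a face, without the usual shift by 1. *)
Definition full_complex (X : finType) (r : nat) : {set {set X}} :=
  [set Y : {set X} | (#|Y| <= r)%N]%SET.

(* Main.v *)
(** Among any [m + 2] of the affine functionals [x |-> a_e . x - b_e] on R^m
    there is a nontrivial linear relation.  If [m < min (2r, n - 1)], there are
    [m + 2 <= n] hyperplanes to choose from, and one of the two sign classes of
    the coefficients has at most [r] elements.  The face given by that class is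
    realized by a point at which every term of the relation is nonnegative and
    some term is positive, a contradiction.

    The coordinate hyperplanes of R^n together with the open convex cone on
    which any [r + 1] coordinates have negative sum realize the complex, so that
    the Euclidean dimension is attained. *)
Require Import Defs.
From mathcomp Require Import all_boot all_order all_algebra.
From mathcomp Require Import all_classical all_reals all_analysis.
From mathcomp Require Import zify.

Set Implicit Arguments.
Unset Strict Implicit.
Unset Printing Implicit Defensive.

Import Order.TTheory GRing.Theory Num.Theory.
Import numFieldNormedType.Exports.

Local Open Scope classical_set_scope.
Local Open Scope ring_scope.

(** The [m + 2] rows [(a i, b i)] live in a space of dimension [m + 1], so the matrix that they form
    has a nonzero left kernel vector; its entries are the coefficients. *)
Lemma affine_dependence (R : realType) (m : nat)
    (a : 'I_m.+2 -> 'rV[R]_m) (b : 'I_m.+2 -> R) :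
  exists2 l : 'I_m.+2 -> R, exists i, l i != 0 &
    forall x, \sum_i l i * (Defs.dotmx (a i) x - b i) = 0.
Proof.
pose A : 'M[R]_(m.+2, m + 1) := row_mx (\matrix_i a i) (\col_i b i).
have kerN0 : kermx A != 0.
  rewrite -mxrank_eq0 mxrank_ker -lt0n subn_gt0.
  by rewrite (leq_ltn_trans (rank_leq_col A)) // addn1.
have /rowV0Pn[v /sub_kermxP vA vN0] := kerN0.
exists (v 0); first by apply/rV0Pn.
move=> x; move: vA => /eqP; rewrite mul_mx_row row_mx_eq0.
move=> /andP[/eqP/matrixP vA /eqP/matrixP vB].
under eq_bigr do rewrite mulrBr.
rewrite sumrB.
have -> : \sum_k v 0 k * b k = 0.
  have := vB 0 0; rewrite !mxE => vb0; rewrite -[RHS]vb0.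
  by apply: eq_bigr => k _; rewrite !mxE.
rewrite subr0 /Defs.dotmx.
under eq_bigr do rewrite mulr_sumr.
rewrite exchange_big big1 // => j _.
have := vA 0 j; rewrite !mxE => vj0.
rewrite -[RHS](mul0r (x 0 j)) -[X in _ = X * _]vj0 mulr_suml.
by apply: eq_bigr => k _; rewrite !mxE mulrA.
Qed.

(** Each product [l i * f i] is nonnegative, and it is positive wherever [l i] is nonzero, so
    nothing can cancel. *)
Lemma sign_dependence_neq0 (R : realType) (I : finType) (l f : I -> R) :
  (exists i, l i != 0) -> (forall i, 0 < l i -> 0 < f i) ->
  (forall i, l i <= 0 -> f i < 0) -> \sum_i l i * f i != 0.
Proof.
move=> [i li0] fpos fneg.
have term_ge0 j : 0 <= l j * f j.
  have [lj|lj] := leP (l j) 0; last by rewrite mulr_ge0 ?(ltW (fpos _ lj)) ?ltW.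
  by rewrite mulr_le0 // ltW ?fneg.
rewrite gt_eqF // lt_neqAle sumr_ge0 // eq_sym psumr_neq0 // andbT.
apply/hasP; exists i; rewrite ?mem_index_enum //= lt_neqAle term_ge0 andbT.
rewrite eq_sym mulf_neq0 //.
have [lj|lj] := leP (l i) 0; first by rewrite lt_eqF ?fneg.
by rewrite gt_eqF ?fpos.
Qed.

Lemma realization_dim_ge (R : realType) (X : finType) (r m : nat) :
  has_realization R (full_complex X r) m -> (minn (2 * r) (#|X| - 1) <= m)%N.
Proof.
move=> [a [b [K [_ _ _ real]]]]; rewrite leqNgt; apply/negP => mlt.
have mX : (m.+2 <= #|X|)%N by lia.
pose g (i : 'I_m.+2) : X := enum_val (widen_ord mX i).
have g_inj : injective g.
  by move=> i j /enum_val_inj/(congr1 val) ij; apply: val_inj.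
have [l lN0 ldep] := affine_dependence (a \o g) (b \o g).
(* Stated for an arbitrary relation [s], to serve both [l] and its negative. *)
have small_class (s : 'I_m.+2 -> R) : (exists i, s i != 0) ->
    (forall x, \sum_i s i * (Defs.dotmx (a (g i)) x - b (g i)) = 0) ->
    (#|[set i | (0 < s i)%R]%SET| <= r)%N -> False.
  move=> sN0 sdep scard.
  pose Y := (g @: [set i | 0 < s i])%SET.
  have /real[x [_ xpos xneg]] : Y \in full_complex X r.
    by rewrite inE card_imset.
  move: (sdep x); apply/eqP; apply: sign_dependence_neq0 => [//|i si|i si].
  - by rewrite subr_gt0; apply: xpos; rewrite mem_imset // inE.
  - by rewrite subr_lt0; apply: xneg; rewrite mem_imset // inE -leNgt.
have [lr|lr] := leqP #|[set i | (0 < l i)%R]%SET| r; first exact: small_class lr.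
apply: (small_class (fun i => - l i)).
- by case: lN0 => i li; exists i; rewrite oppr_eq0.
- move=> x; rewrite -[RHS]oppr0 -[X in _ = - X](ldep x) -sumrN.
  by apply: eq_bigr => i _; rewrite mulNr.
(* The two sign classes are disjoint and share at most [m + 2 <= 2r + 1] indices; as the positive
   one has more than [r], at most [r] are left for the negative one. *)
- have := max_card [set i | l i != 0]%SET.
  have -> : [set i | l i != 0]%SET =
      ([set i | 0 < l i] :|: [set i | 0 < - l i])%SET.
    by apply/setP => i; rewrite !inE oppr_gt0 neq_lt orbC.
  rewrite cardsU disjoint_setI0 ?cards0 ?card_ord; first by lia.
  apply/pred0P => i /=; rewrite !inE oppr_gt0.
  by apply/negP => /andP[/lt_trans/[apply]]; rewrite ltxx.
Qed.

Definition negative_sums_cone (R : realType) (X : finType) (k : nat) :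
    set 'rV[R]_#|X| :=
  [set x : 'rV[R]_#|X| | forall Z : {set X}, #|Z| = k ->
    \sum_(e in Z) x 0 (enum_rank e) < 0]%classic.

Lemma open_relatively_open (R : realType) (m : nat) (A : set 'rV[R]_m) :
  open A -> relatively_open A.
Proof.
move=> Aopen; exists A => //; apply/seteqP; split=> [x Ax|x []//].
split=> //; exists 1%N, (fun=> 1), (fun=> x).
by split=> //; rewrite big_ord1 ?scale1r.
Qed.

Lemma negative_sums_cone_open (R : realType) (X : finType) (k : nat) :
  open (@negative_sums_cone R X k).
Proof.
rewrite openE => x Kx; rewrite /interior /negative_sums_cone.
(* There are finitely many sets [Z], so each strict inequality may be handled separately. *)
apply: (@filter_forall _ {set X} _ _ (nbhs_filter x)) => Z.
have [cZ|cZ] := eqVneq #|Z| k; last first.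
  by apply: nearW => y /eqP; rewrite (negPf cZ).
have sum_cont : continuous (fun y : 'rV[R]_#|X| =>
    \sum_(e in Z) y 0 (enum_rank e)).
  apply: continuous_big => [|e _]; last exact: coord_continuous.
  exact: add_continuous.
apply: (@filterS _ _ (nbhs_filter x) _ _ _ (sum_cont x _ (lt_nbhsl (Kx Z cZ)))).
by move=> y.
Qed.

Lemma negative_sums_cone_convex (R : realType) (X : finType) (k : nat) :
  convex_set (@negative_sums_cone R X k).
Proof.
(* Restricting to [0 < t < 1] makes both weights positive, which keeps the inequalities strict. *)
apply/convex_setW => x y; rewrite !inE => Kx Ky t t0 t1; rewrite inE => Z cZ.
under eq_bigr do rewrite !mxE.
rewrite big_split /= -!mulr_sumr.
rewrite -[ltRHS]addr0 ltrD //.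
  by rewrite pmulr_rlt0 //; apply: Kx.
by rewrite pmulr_rlt0 ?unstable.onem_gt0 //; apply: Ky.
Qed.

Lemma dotmx_delta (R : realType) (m : nat) (i : 'I_m) (x : 'rV[R]_m) :
  Defs.dotmx (delta_mx 0 i) x = x 0 i.
Proof.
rewrite /Defs.dotmx (bigD1 i) //= mxE !eqxx mul1r big1 ?addr0 // => j ji.
by rewrite mxE (negPf ji) andbF mul0r.
Qed.

Lemma full_complex_realization (R : realType) (X : finType) (r : nat) :
  has_realization R (full_complex X r) #|X|.
Proof.
exists (fun e => delta_mx 0 (enum_rank e)), (fun=> 0).
exists (@negative_sums_cone R X r.+1); split.
- move=> e; apply/negP => /eqP/matrixP/(_ 0 (enum_rank e)).
  by rewrite !mxE !eqxx; apply/eqP/oner_neq0.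
- exact/open_relatively_open/negative_sums_cone_open.
- exact: negative_sums_cone_convex.
- move=> Y; rewrite inE; split=> [cY|[x [Kx xpos _]]].
  (* The value [- r.+1] is chosen so that a single coordinate outside [Y] outweighs [r] coordinates
     equal to 1. *)
  + pose x : 'rV[R]_#|X| :=
      \row_i (if enum_val i \in Y then 1 else - r.+1%:R).
    have xE e : x 0 (enum_rank e) = if e \in Y then 1 else - r.+1%:R.
      by rewrite mxE enum_rankK.
    exists x; split=> [Z cZ|e eY|e eY]; last 2 first.
    * by rewrite /pos_side /= dotmx_delta xE eY.
    * by rewrite /neg_side /= dotmx_delta xE (negPf eY) oppr_lt0.
    have /subsetPn[e eZ eY] : ~~ (Z \subset Y).
      by apply/negP => /subset_leq_card; rewrite cZ leqNgt ltnS cY.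
    rewrite (bigD1 e) //= xE (negPf eY) addrC subr_lt0.
    (* Counting [Z] by ones allows a termwise comparison over [Z] without [e]; the 1 split off for
       [e] gives strictness. *)
    have -> : r.+1%:R = 1 + \sum_(i in Z | i != e) 1 :> R.
      by rewrite -cZ -sum1_card natr_sum (bigD1 e).
    rewrite (@le_lt_trans _ _ (\sum_(i in Z | i != e) 1)) ?ltrDr //.
    by apply: ler_sum => i _; rewrite xE; case: ifP.
  (* A larger [Y] would contain [r + 1] elements with positive coordinates, whose sum the cone
     forces to be negative. *)
  + rewrite leqNgt; apply/negP => rY.
    have /card_geqP[s [s_uniq s_size sY]] := rY.
    have := Kx [set e in s]%SET.
    rewrite cardsE (card_uniqP s_uniq) => /(_ s_size).
    apply/negP; rewrite -leNgt; apply: sumr_ge0 => e; rewrite inE => /sY.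
    by move=> /xpos; rewrite /pos_side /= dotmx_delta => /ltW.
Qed.

(** Once some realization exists, a least dimension exists by well-ordering, so [xget] returns a
    genuine minimum and not its default 0. *)
Lemma euclidean_dim_realization (R : realType) (U : finType)
    (S : {set {set U}}) (m : nat) :
  has_realization R S m -> has_realization R S (euclidean_dim R S).
Proof.
move=> real.
have ex : exists k, `[< has_realization R S k >] by exists m; apply/asboolP.
have [k /asboolP kreal kmin] := ex_minnP ex.
rewrite /euclidean_dim; case: xgetP => [_ _ []//|/(_ k)[]].
by split=> // j /asboolP/kmin.
Qed.

Theorem theorem44 (R : realType) (X : finType) (r n : nat) (hX : #|X| = n) :
  (minn (2 * r) (n - 1) <= euclidean_dim R (full_complex X r))%N.
Proof.
rewrite -hX; apply: realization_dim_ge.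
exact: euclidean_dim_realization (full_complex_realization R X r).
Qed.
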